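(* Let $k$ be a field of characteristic zero, let $(D,\prec,\succ,\Phi)$ be a twisted dendriform algebra over $k$, let $\overline D=D\oplus k\mathbf 1$ be its unital augmentation, and let $a\in D$. Let $X\in\overline D[[\lambda]]$ be the solution of $$X=\mathbf 1+\lambda a\prec\Phi(X),$$ and let $\Omega':=\Omega'(\lambda a)\in\lambda D[[\lambda]]$ be the element such that $X=\exp^*(\Omega')$. Then $Y=\exp^*(-\Omega')$ is the solution in $\overline D[[\lambda]]$ of $$Y=\mathbf 1-Y\succ\lambda a,$$ and $\Omega'$ satisfies the recursive equation $$\Omega'(\lambda a)=\frac{R_\lhd(\Omega')}{1-e^{-R_\lhd(\Omega')}}(\lambda a)=\sum_{m\ge0}(-1)^m\frac{B_m}{m!}R_\lhd^m(\Omega')(\lambda a),$$ or alternatively $$\Omega'(\lambda a)=\frac{L_\rhd(\Omega')}{e^{L_\rhd(\Omega')}-1}(\lambda a)=\sum_{m\ge0}\frac{B_m}{m!}L_\rhd^m(\Omega')(\lambda a).$$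
   Context: A twisted dendriform algebra over a field $k$ is a $k$-vector space $D$ with two bilinear operations $\prec,\succ$ and a linear automorphism $\Phi$ of $D$ such that for all $x,y,z\in D$: $\Phi(x\prec y)=\Phi(x)\prec\Phi(y)$; $\Phi(x\succ y)=\Phi(x)\succ\Phi(y)$; $(x\prec y)\prec z=x\prec(y*z)$; $(x\succ y)\prec z=x\succ(y\prec z)$; $x\succ(y\succ z)=(x*y)\succ z$; where $x*y:=x\succ y+x\prec\Phi(y)$. The product $*$ is associative. The unital augmentation $\overline D=D\oplus k\mathbf 1$ is defined by $a\prec\mathbf 1:=a=:\mathbf 1\succ a$ and $\mathbf 1\prec a:=0=:a\succ\mathbf 1$ for $a\in D$, together with $\Phi(\mathbf 1)=\mathbf 1$ and $\mathbf 1*\mathbf 1=\mathbf 1$ (so $a*\mathbf 1=\mathbf 1*a=a$); $\mathbf 1\prec\mathbf 1$ and $\mathbf 1\succ\mathbf 1$ are left undefined. All operations and $\Phi$ are extended $k[[\lambda]]$-(bi)linearly and $\lambda$-adically continuously to formal power series in the commuting variable $\lambda$. For $x\in\lambda D[[\lambda]]$, $\exp^*(x):=\sum_{n\ge0}x^{*n}/n!$ with $x^{*0}=\mathbf 1$; $\exp^*$ is a bijection from $\lambda D[[\lambda]]$ onto $\mathbf 1+\lambda D[[\lambda]]$. The products $\rhd$ and $\lhd$ are $x\rhd y:=x\succ y-y\prec\Phi(x)$ and $x\lhd y:=-y\rhd x=x\prec\Phi(y)-y\succ x$, with multiplication operators $L_\rhd(x)(y):=x\rhd y$ and $R_\lhd(x)(y):=y\lhd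 x$. The Bernoulli numbers $B_m$ are defined by $\frac{z}{e^z-1}=\sum_{m\ge0}\frac{B_m}{m!}z^m$ (so $B_1=-\tfrac12$). *)

(* Defs.v *)
From HB Require Import structures.
From mathcomp Require Import all_boot all_order all_algebra.
From mathcomp Require Import all_classical.
Set Implicit Arguments.
Unset Strict Implicit.
Unset Printing Implicit Defensive.
Import GRing.Theory.
Local Open Scope ring_scope.

HB.mixin Record isTwistedDendriform (k : fieldType) D of GRing.Lmodule k D := {
  tprec : D -> D -> D;
  tsucc : D -> D -> D;
  tPhi : D -> D;
  tprec_linearl : forall y, linear (tprec^~ y);
  tprec_linearr : forall x, linear (tprec x);
  tsucc_linearl : forall y, linear (tsucc^~ y);
  tsucc_linearr : forall x, linear (tsucc x);
  tPhi_linear : linear tPhi;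
  tPhi_bij : bijective tPhi;
  tPhi_prec : forall x y, tPhi (tprec x y) = tprec (tPhi x) (tPhi y);
  tPhi_succ : forall x y, tPhi (tsucc x y) = tsucc (tPhi x) (tPhi y);
  tprec_prec : forall x y z,
    tprec (tprec x y) z = tprec x (tsucc y z + tprec y (tPhi z));
  tsucc_prec : forall x y z,
    tprec (tsucc x y) z = tsucc x (tprec y z);
  tsucc_succ : forall x y z,
    tsucc x (tsucc y z) = tsucc (tsucc x y + tprec x (tPhi y)) z
}.

#[short(type="twistedDendriformType")]
HB.structure Definition TwistedDendriform (k : fieldType) :=
  {D of GRing.Lmodule k D & isTwistedDendriform k D}.

Section Products.
Variables (k : fieldType) (D : twistedDendriformType k).
Implicit Types x y : D.

Definition tstar x y : D := tsucc x y + tprec x (tPhi y).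
Definition trhd x y : D := tsucc x y - tprec y (tPhi x).
Definition tlhd x y : D := - trhd y x.

Lemma tlhdE x y : tlhd x y = tprec x (tPhi y) - tsucc y x.
Proof. by rewrite /tlhd /trhd opprB. Qed.

End Products.

(* The pair (x, c) stands for x + c 1. *)
Definition augm (k : fieldType) (D : twistedDendriformType k) : Type :=
  (D * k^o)%type.

Section Augmentation.
Variables (k : fieldType) (D : twistedDendriformType k).

Implicit Types x y : augm D.

Definition aug_one : augm D := (0, 1).
Definition aug_in (d : D) : augm D := (d, 0).
Definition aug_Phi x : augm D := (tPhi x.1, x.2).

(* The products of 1 with itself under the two half-products are undefined;
   the total functions below give them the junk value 0. They are only meant
   to be applied when one of the two arguments lies in D. *)
Definition aug_prec x y : augm D := aug_in (tprec x.1 y.1 + (y.2 : k) *: x.1).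
Definition aug_succ x y : augm D := aug_in (tsucc x.1 y.1 + (x.2 : k) *: y.1).

Definition aug_star x y : augm D :=
  (tstar x.1 y.1 + (y.2 : k) *: x.1 + (x.2 : k) *: y.1, (x.2 : k) * y.2).

Let tprec0 (d : D) : tprec d 0 = 0.
Proof.
have := tprec_linearr d 1 0 0.
by rewrite !scale1r addr0 -[LHS]addr0 => /addrI.
Qed.

Let t0prec (d : D) : tprec 0 d = 0.
Proof.
have := tprec_linearl d 1 0 0.
by rewrite !scale1r addr0 -[LHS]addr0 => /addrI.
Qed.

Let tsucc0 (d : D) : tsucc d 0 = 0.
Proof.
have := tsucc_linearr d 1 0 0.
by rewrite !scale1r addr0 -[LHS]addr0 => /addrI.
Qed.

Let t0succ (d : D) : tsucc 0 d = 0.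
Proof.
have := tsucc_linearl d 1 0 0.
by rewrite !scale1r addr0 -[LHS]addr0 => /addrI.
Qed.

Lemma aug_prec1 (d : D) : aug_prec (aug_in d) aug_one = aug_in d.
Proof. by rewrite /aug_prec /= tprec0 add0r scale1r. Qed.

Lemma aug_1prec (d : D) : aug_prec aug_one (aug_in d) = 0.
Proof. by rewrite /aug_prec /= t0prec add0r scaler0. Qed.

Lemma aug_1succ (d : D) : aug_succ aug_one (aug_in d) = aug_in d.
Proof. by rewrite /aug_succ /= t0succ add0r scale1r. Qed.

Lemma aug_succ1 (d : D) : aug_succ (aug_in d) aug_one = 0.
Proof. by rewrite /aug_succ /= tsucc0 add0r scaler0. Qed.

Lemma aug_starE (d e : D) :
  aug_star (aug_in d) (aug_in e) = aug_in (tstar d e).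
Proof. by rewrite /aug_star /= !scale0r !addr0 mulr0. Qed.

End Augmentation.

Arguments aug_one {k D}.

(* V[[lambda]] is the type nat -> V of coefficient sequences, with its
   pointwise module structure; ps_mon n v is v lambda^n. *)
Section PowerSeries.

Definition ps_mon (V : zmodType) (n : nat) (v : V) : nat -> V :=
  fun i => if i == n then v else 0.

(* The coefficientwise, hence lambda-adically continuous, extension of a map
   and the Cauchy product extending a bilinear map. *)
Definition ps_map (U V : Type) (f : U -> V) (x : nat -> U) : nat -> V :=
  fun n => f (x n).

Definition ps_bil (U V : Type) (W : zmodType) (op : U -> V -> W)
    (x : nat -> U) (y : nat -> V) : nat -> W :=
  fun n => \sum_(i < n.+1) op (x i) (y (n - i)%N).

(* Sum of a family with u n in lambda^n V[[lambda]]: only the terms of index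
   at most i contribute to the coefficient of lambda^i; cf. ps_sum_cvg. *)
Definition ps_sum (V : zmodType) (u : nat -> nat -> V) : nat -> V :=
  fun i => \sum_(n < i.+1) u n i.

Lemma ps_sum_cvg (V : zmodType) (u : nat -> nat -> V) :
  (forall n i, (i < n)%N -> u n i = 0) ->
  forall N m i, (N <= m)%N -> (i < N)%N ->
    (\sum_(n < m) u n) i = ps_sum u i.
Proof.
move=> u0 N m i Nm iN; have im : (i.+1 <= m)%N by apply: leq_trans iN Nm.
rewrite fct_sumE /ps_sum -!(big_mkord predT (u^~ i)).
rewrite (big_cat_nat (leq0n _) im) /=.
rewrite [X in _ + X]big_nat_cond [X in _ + X]big1 ?addr0 // => n.
by rewrite andbT => /andP[/u0].
Qed.

(* For f = \sum_m f_m z^m in k[[z]], the value f(T)(v) of f at an operator T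
   that raises the lambda-adic order by at least 1. *)
Definition ps_eval (k : fieldType) (V : lmodType k) (f : nat -> k)
    (T : (nat -> V) -> (nat -> V)) (v : nat -> V) : nat -> V :=
  ps_sum (fun m => f m *: iter m T v).

End PowerSeries.

Section ScalarSeries.
Variable k : fieldType.
Implicit Types f g h : nat -> k.

Definition ps_mul f g : nat -> k := ps_bil *%R f g.

(* The quotient in k[[z]], which may exist for g of positive order; see
   ps_divK and ps_div_unique. *)
Definition ps_div f g : nat -> k :=
  xget 0 [set h : nat -> k | ps_mul h g = f].

Lemma ps_mul_mon1 h n g : g 0 = 0 ->
  ps_mul h g n.+1 = \sum_(i < n) h i * g (n.+1 - i)%N + h n * g 1.
Proof.
move=> g0; rewrite /ps_mul /ps_bil big_ord_recr big_ord_recr /= subnn g0 mulr0.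
by rewrite addr0 subSnn.
Qed.

Let quot_aux f g : nat -> seq k :=
  fix aux n := if n is m.+1 then
    let s := aux m in
    rcons s ((f m.+1 - \sum_(i < m) s`_i * g (m.+1 - i)%N) / g 1)
  else [::].

Lemma ps_divK f g : f 0 = 0 -> g 0 = 0 -> g 1 != 0 ->
  ps_mul (ps_div f g) g = f.
Proof.
move=> f0 g0 g1; apply: (@xgetPex _ 0 [set h : nat -> k | ps_mul h g = f]).
pose s := quot_aux f g.
have sS n : s n.+1 =
  rcons (s n) ((f n.+1 - \sum_(i < n) (s n)`_i * g (n.+1 - i)%N) / g 1) by [].
have ss n : size (s n) = n by elim: n => // n IH; rewrite sS size_rcons IH.
pose h n := (s n.+1)`_n.
have sh n i : (i < n)%N -> (s n)`_i = h i.
  elim: n => // n IH; rewrite ltnS leq_eqVlt => /predU1P[->//|lin].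
  by rewrite sS nth_rcons ss lin IH.
exists h; apply/funext => -[|n] /=.
  by rewrite /ps_mul /ps_bil big_ord1 /= g0 mulr0 f0.
rewrite ps_mul_mon1 //.
have -> : h n = (f n.+1 - \sum_(i < n) h i * g (n.+1 - i)%N) / g 1.
  rewrite {1}/h sS nth_rcons ss ltnn eqxx; congr (_ / _); congr (_ - _).
  by apply: eq_bigr => i _; rewrite sh.
by rewrite divfK // addrCA subrr addr0.
Qed.

Lemma ps_div_unique f g h : g 0 = 0 -> g 1 != 0 ->
  ps_mul h g = f -> ps_div f g = h.
Proof.
move=> g0 g1 hgf; have f0 : f 0 = 0.
  by rewrite -hgf /ps_mul /ps_bil big_ord1 /= g0 mulr0.
have := ps_divK f0 g0 g1; rewrite -{2}hgf; move: (ps_div f g) => h' e.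
apply/funext => n; have [m] := ubnP n; elim: m n => // m IH n; rewrite ltnS => nm.
have := congr1 (@^~ n.+1) e; rewrite /= !ps_mul_mon1 //.
rewrite (eq_bigr (fun i : 'I_n => h i * g (n.+1 - i)%N)) => [/addrI/mulIf|i _].
  exact.
by rewrite IH // (leq_trans _ nm).
Qed.

(* z and e^{cz} *)
Definition ps_z : nat -> k := ps_mon 1 1.
Definition ps_exp (c : k) : nat -> k := fun n => c ^+ n / n`!%:R.

(* z / (e^z - 1) and z / (1 - e^{-z}) *)
Definition todd_minus : nat -> k := ps_div ps_z (ps_exp 1 - ps_mon 0 1).
Definition todd_plus : nat -> k := ps_div ps_z (ps_mon 0 1 - ps_exp (- 1)).

Definition bernoulli (m : nat) : k := m`!%:R * todd_minus m.

End ScalarSeries.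

Section TwistedDendriformSeries.
Variables (k : fieldType) (D : twistedDendriformType k).

Fixpoint ps_star_pow (x : nat -> augm D) (n : nat) : nat -> augm D :=
  if n is m.+1 then ps_bil (@aug_star k D) x (ps_star_pow x m)
  else ps_mon 0 aug_one.

(* Meaningful for x in lambda D[[lambda]]. *)
Definition exp_star (x : nat -> D) : nat -> augm D :=
  ps_sum (fun n => (n`!%:R^-1 : k) *: ps_star_pow (ps_map (@aug_in k D) x) n).

Definition L_rhd (x y : nat -> D) : nat -> D := ps_bil (@trhd k D) x y.
Definition R_lhd (x y : nat -> D) : nat -> D := ps_bil (@tlhd k D) y x.

Definition X_solution (a : D) (X : nat -> augm D) : Prop :=
  X = ps_mon 0 aug_one +
      ps_bil (@aug_prec k D) (ps_mon 1 (aug_in a)) (ps_map (@aug_Phi k D) X).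

Definition Y_solution (a : D) (Y : nat -> augm D) : Prop :=
  Y = ps_mon 0 aug_one -
      ps_bil (@aug_succ k D) Y (ps_mon 1 (aug_in a)).

End TwistedDendriformSeries.

(* Main.v *)
(* With x <' y := x < Phi(y) in place of <, a twisted dendriform algebra is an
   ordinary one, so D is a bimodule over its unital augmentation, with left
   action > and right action <'. Let l and r be the actions of Omega' on the
   left and on the right; they commute and L_rhd(Omega') = l - r. The powers of
   Omega' satisfy Omega'^(n+1) = l(Omega'^n) + r^n(Omega'), hence
     exp(Omega') - 1 = ((e^l - e^r) / (l - r))(Omega') = b <' exp(Omega')
   with b = ((e^L - 1) / L)(Omega') and L = L_rhd(Omega'). Comparing with
   X - 1 = lambda a <' X, where X is invertible, gives b = lambda a, which is
   the recursion. Exchanging l and r and replacing Omega' by - Omega' gives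
   exp(- Omega') - 1 = - exp(- Omega') > b, the equation of Y. Existence and
   uniqueness of X, Y and Omega' hold because the three equations are fixed
   point equations for lambda-adic contractions. *)
From HB Require Import structures.
Require Import Defs.
From mathcomp Require Import all_boot all_order all_algebra.
From mathcomp Require Import all_classical.
Set Implicit Arguments.
Unset Strict Implicit.
Unset Printing Implicit Defensive.
Import GRing.Theory.
Local Open Scope ring_scope.

(** * Linear maps given by a proof of linearity, and a double sum *)

Section LinearProp.
Variables (k : fieldType) (U V : lmodType k) (f : U -> V).
Hypothesis f_lin : linear f.

Let fL : {linear U -> V} :=
  HB.pack f (GRing.isLinear.Build k U V _ f f_lin).

Lemma lin0 : f 0 = 0. Proof. exact: (linear0 fL). Qed.
Lemma linN u : f (- u) = - f u. Proof. exact: (linearN fL). Qed.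
Lemma linD u v : f (u + v) = f u + f v. Proof. exact: (linearD fL). Qed.
Lemma linB u v : f (u - v) = f u - f v. Proof. exact: (linearB fL). Qed.
Lemma linZ c u : f (c *: u) = c *: f u.
Proof. by rewrite -[c *: u]addr0 f_lin lin0 addr0. Qed.
Lemma lin_sum I (r : seq I) P (F : I -> U) :
  f (\sum_(i <- r | P i) F i) = \sum_(i <- r | P i) f (F i).
Proof. exact: (linear_sum fL). Qed.
End LinearProp.

(** Both sides run over the pairs (p, q) with p + q < n, by antidiagonals on the left and by rows on
    the right. *)
Lemma sum_triangle (V : nmodType) (G : nat -> nat -> V) n :
  \sum_(i < n) \sum_(j < i.+1) G j (i - j)%N =
  \sum_(j < n) \sum_(i < n - j) G j i.
Proof.
elim: n => [|n IH]; first by rewrite !big_ord0.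
rewrite big_ord_recr /= IH [RHS]big_ord_recr /= subSnn big_ord1.
rewrite big_ord_recr /= subnn addrA -big_split /=.
congr (_ + _); apply: eq_bigr => j _.
by rewrite subSn ?[RHS]big_ord_recr // ltnW.
Qed.

(** * Lambda-adic order and evaluation of scalar series at operators *)

Section Series.
Variables (k : fieldType).
Implicit Types V W : lmodType k.

(** Membership in lambda^n V[[lambda]]. These submodules are the basic neighbourhoods of 0, so
    convergence and contraction are expressed through them. *)
Definition vanish {V : lmodType k} n (v : nat -> V) :=
  forall i, (i < n)%N -> v i = 0.

Lemma vanish_le V m n (v : nat -> V) : (m <= n)%N -> vanish n v -> vanish m v.
Proof. by move=> mn vn i im; apply: vn; apply: leq_trans mn. Qed.

Lemma vanishZ V n c (v : nat -> V) : vanish n v -> vanish n (c *: v).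
Proof. by move=> vn i /vn vi; rewrite fctE vi scaler0. Qed.

Lemma vanishD V n (u v : nat -> V) :
  vanish n u -> vanish n v -> vanish n (u + v).
Proof. by move=> un vn i lin; rewrite fctE un // vn // addr0. Qed.

Lemma eq_ps_sum V (u w : nat -> nat -> V) : u =1 w -> ps_sum u = ps_sum w.
Proof. by move=> uw; apply/funext => i; apply: eq_bigr => n _; rewrite uw. Qed.

Lemma ps_sumS V (u : nat -> nat -> V) : (forall n, vanish n (u n)) ->
  ps_sum u = u 0 + ps_sum (fun n => u n.+1).
Proof.
move=> u_van; apply/funext => i.
rewrite /ps_sum !fctE big_ord_recl [X in _ = _ + X]big_ord_recr /=.
by rewrite (u_van i.+1 i) // addr0.
Qed.

(** A linear map that preserves the order is continuous: the tail of the sum beyond index i lies in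
    lambda^(i+1) V[[lambda]], hence so does its image. *)
Lemma lin_ps_sum V W (T : (nat -> V) -> nat -> W) (u : nat -> nat -> V) :
  linear T -> (forall n v, vanish n v -> vanish n (T v)) ->
  (forall n, vanish n (u n)) -> T (ps_sum u) = ps_sum (fun n => T (u n)).
Proof.
move=> T_lin T_van u_van; apply/funext => i.
have /T_van/(_ i (leqnn _)) : vanish i.+1 (ps_sum u - \sum_(n < i.+1) u n).
  move=> j ji; rewrite !fctE; apply/eqP; rewrite subr_eq0 eq_sym; apply/eqP.
  exact: (ps_sum_cvg u_van ji (ltnSn _)).
rewrite linB // !fctE => /eqP; rewrite subr_eq0 => /eqP ->.
by rewrite lin_sum // fct_sumE.
Qed.

(** Only the finitely many terms with p + q <= i reach the coefficient of lambda^i, so the double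
    sum may be collected by total degree. *)
Lemma ps_sum_ps_sum V (u : nat -> nat -> nat -> V) :
  (forall p q, vanish (p + q) (u p q)) ->
  ps_sum (fun p => ps_sum (u p)) =
  ps_sum (fun n => \sum_(p < n.+1) u p (n - p)%N).
Proof.
move=> u_van; apply/funext => i; rewrite /ps_sum.
under [RHS]eq_bigr do rewrite fct_sumE.
rewrite (sum_triangle (fun p q => u p q i)); apply: eq_bigr => p _.
rewrite -!(big_mkord xpredT (fun q => u p q i)).
rewrite (big_cat_nat (leq0n _) (leq_subr p i.+1)) /=.
rewrite [X in _ + X]big_nat_cond [X in _ + X]big1 ?addr0 // => q.
by rewrite andbT leq_subLR => /andP[ipq _]; apply: u_van.
Qed.

(* The operators at which ps_eval has its intended meaning. *)
Record raising {V : lmodType k} (T : (nat -> V) -> nat -> V) : Prop := {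
  raising_lin : linear T;
  raising_vanish : forall n v, vanish n v -> vanish n.+1 (T v)
}.

Lemma iter_lin V (T : (nat -> V) -> nat -> V) n : linear T -> linear (iter n T).
Proof. by move=> T_lin c u v; elim: n => //= n ->; rewrite T_lin. Qed.

Lemma iter_vanish V (T : (nat -> V) -> nat -> V) m n v :
  raising T -> vanish n v -> vanish (m + n) (iter m T v).
Proof.
by move=> T_r v_van; elim: m => //= m IH; apply: raising_vanish.
Qed.

Lemma iter_vanish0 V (T : (nat -> V) -> nat -> V) m v :
  raising T -> vanish m (iter m T v).
Proof.
move=> T_r; have v0 : vanish 0 v by [].
by have := iter_vanish (m := m) T_r v0; rewrite addn0.
Qed.

Lemma raisingB V (S T : (nat -> V) -> nat -> V) :
  raising S -> raising T -> raising (fun v => S v - T v).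
Proof.
move=> [S_lin S_van] [T_lin T_van]; split=> [c u v|n v vn i ni].
  by rewrite S_lin T_lin scalerBr opprD addrACA.
by rewrite !fctE (S_van n) // (T_van n) // subrr.
Qed.

(** Two distinct operators are allowed because the exponential combines a series in [r] with a
    series in [l] - [r]. *)
Lemma ps_eval_ps_eval V (S T : (nat -> V) -> nat -> V) (f h : nat -> k) v :
  raising S -> raising T ->
  ps_eval f S (ps_eval h T v) =
  ps_sum (fun n => \sum_(p < n.+1)
    (f p * h (n - p)%N) *: iter p S (iter (n - p) T v)).
Proof.
move=> S_r T_r; rewrite /ps_eval.
rewrite -(ps_sum_ps_sum
  (u := fun p q => (f p * h q) *: iter p S (iter q T v))); last first.
  by move=> p q; apply/vanishZ/iter_vanish => //; apply: iter_vanish0.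
apply: eq_ps_sum => p.
have C_lin : linear (fun w : nat -> V => f p *: iter p S w).
  by move=> c u w; rewrite iter_lin ?scalerDr ?scalerA 1?mulrC //; case: S_r.
rewrite (lin_ps_sum C_lin).
- apply: eq_ps_sum => q; rewrite linZ ?scalerA //.
  by apply: iter_lin; case: S_r.
- move=> n w wn; apply/vanishZ/(vanish_le (leq_addl p n)).
  exact: iter_vanish.
- by move=> n; apply/vanishZ/iter_vanish0.
Qed.

Lemma ps_eval_mul V (T : (nat -> V) -> nat -> V) (f h : nat -> k) v :
  raising T -> ps_eval f T (ps_eval h T v) = ps_eval (ps_mul f h) T v.
Proof.
move=> T_r; rewrite ps_eval_ps_eval //; apply: eq_ps_sum => n.
rewrite /ps_mul /ps_bil scaler_suml; apply: eq_bigr => p _.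
by rewrite -iterD subnKC // -ltnS.
Qed.

Lemma ps_eval1 V (T : (nat -> V) -> nat -> V) v : ps_eval (ps_mon 0 1) T v = v.
Proof.
apply/funext => i; rewrite /ps_eval /ps_sum big_ord_recl /= scale1r.
by rewrite big1 ?addr0 // => n _; rewrite fctE /= scale0r.
Qed.

End Series.

(** * Fixed points and bilinear operations on power series *)

Section FixedPoint.
Variables (k : fieldType) (V : lmodType k) (F : (nat -> V) -> nat -> V).
Hypothesis F_contr :
  forall n x y, vanish n (x - y) -> vanish n.+1 (F x - F y).

Lemma vanish_eq (x y : nat -> V) : (forall n, vanish n (x - y)) -> x = y.
Proof.
move=> xy; apply/funext => n; apply/eqP; rewrite -subr_eq0; apply/eqP.
exact: (xy n.+1 n).
Qed.

Lemma fix_unique x y : x = F x -> y = F y -> x = y.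
Proof.
move=> xF yF; apply: vanish_eq; elim=> // n IH.
by rewrite xF yF; apply: F_contr.
Qed.

Lemma fix_exists : exists x, x = F x.
Proof.
(* The limit of the iterates of [F] is read off diagonally: the coefficient of lambda^n is the same
   in all iterates from [z n.+1] on. *)
pose z n := iter n F 0; pose x n := z n.+1 n.
have zS n : vanish n (z n - z n.+1) by elim: n => // n; apply: F_contr.
have zx n : vanish n (x - z n).
  elim: n => // n IH i; rewrite ltnS leq_eqVlt => /predU1P[->|lin].
    by rewrite !fctE subrr.
  have := zS n i lin; have /eqP := IH i lin.
  by rewrite !fctE subr_eq0 => /eqP ->.
exists x; apply: vanish_eq => n i lin; rewrite !fctE.
(* As [x] and [z i] agree below order i, [F x] and [F (z i) = z i.+1] agree up to lambda^i, where
   [z i.+1] has the coefficient [x i]. *)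
have := F_contr (zx i) (ltnSn i); rewrite !fctE => /eqP.
by rewrite subr_eq0 => /eqP ->; rewrite subrr.
Qed.

End FixedPoint.

Section Bilinear.
Variables (k : fieldType) (U V W : lmodType k) (op : U -> V -> W).
Hypotheses (op_linl : forall y, linear (op^~ y)).
Hypotheses (op_linr : forall x, linear (op x)).

Lemma ps_bil_linl y : linear ((ps_bil op)^~ y).
Proof.
move=> c u v; apply/funext => n; rewrite !fctE /ps_bil scaler_sumr -big_split.
by apply: eq_bigr => i _; rewrite /= op_linl.
Qed.

Lemma ps_bil_linr x : linear (ps_bil op x).
Proof.
move=> c u v; apply/funext => n; rewrite !fctE /ps_bil scaler_sumr -big_split.
by apply: eq_bigr => i _; rewrite /= op_linr.
Qed.

Lemma ps_bil_vanish m n x y :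
  vanish m x -> vanish n y -> vanish (m + n) (ps_bil op x y).
Proof.
move=> xm yn i imn; apply: big1 => j _; have [/xm ->|mj] := ltnP j m.
  exact: (lin0 (op_linl _)).
have -> : y (i - j)%N = 0.
  apply: yn; rewrite ltn_subLR; last exact: ltnSE.
  by apply: leq_trans imn _; rewrite leq_add2r.
exact: (lin0 (op_linr _)).
Qed.

Lemma ps_bil_mon0l e y : ps_bil op (ps_mon 0 e) y = ps_map (op e) y.
Proof.
apply/funext => n; rewrite /ps_bil /ps_map big_ord_recl subn0 big1 ?addr0 //.
by move=> i _; apply: (lin0 (op_linl _)).
Qed.

Lemma ps_bil_mon0r x e : ps_bil op x (ps_mon 0 e) = ps_map (op^~ e) x.
Proof.
apply/funext => n; rewrite /ps_bil /ps_map big_ord_recr /= subnn big1 ?add0r //.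
move=> i _; rewrite /ps_mon subn_eq0 leqNgt ltn_ord.
exact: (lin0 (op_linr _)).
Qed.

End Bilinear.

(** Four unrelated operations are allowed so that one lemma covers both module axioms and the
    commutation of the left and right actions. *)
Lemma ps_bilA (k : fieldType) (U V W UV VW Z : lmodType k)
    (op1 : UV -> W -> Z) (op2 : U -> V -> UV)
    (op3 : U -> VW -> Z) (op4 : V -> W -> VW) x y z :
  (forall w, linear (op1^~ w)) -> (forall u, linear (op3 u)) ->
  (forall u v w, op1 (op2 u v) w = op3 u (op4 v w)) ->
  ps_bil op1 (ps_bil op2 x y) z = ps_bil op3 x (ps_bil op4 y z).
Proof.
move=> lin1 lin3 opA; apply/funext => n; rewrite /ps_bil.
under eq_bigr do rewrite (lin_sum (lin1 _)).
under [RHS]eq_bigr do rewrite (lin_sum (lin3 _)).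
pose G j i := op1 (op2 (x j) (y i)) (z (n - (j + i))%N).
transitivity (\sum_(i < n.+1) \sum_(j < i.+1) G j (i - j)%N).
  apply: eq_bigr => i _; apply: eq_bigr => j _.
  by rewrite /G subnKC // -ltnS.
rewrite sum_triangle; apply: eq_bigr => j _.
rewrite subSn ?(ltnSE (ltn_ord j)) //.
by apply: eq_bigr => i _; rewrite /G opA subnDA.
Qed.

(** * The series z / (e^z - 1), its inverse, and its image under z -> -z *)

Section ToddSeries.
Variable k : fieldType.
Hypothesis char0 : [pchar k] =i pred0.

(* (e^z - 1) / z *)
Definition ps_expm1_div : nat -> k := fun n => (n.+1)`!%:R^-1.

Lemma fact_unit n : (n`!%:R : k) != 0.
Proof. by move/pcharf0P: char0 => ->; rewrite -lt0n fact_gt0. Qed.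

Lemma ps_mulC (f g : nat -> k) : ps_mul f g = ps_mul g f.
Proof.
apply/funext => n; rewrite /ps_mul /ps_bil (reindex_inj rev_ord_inj) /=.
apply: eq_bigr => i _; rewrite mulrC subSS subKn //.
by rewrite -ltnS.
Qed.

Let expm1 := ps_exp 1 - ps_mon 0 1 : nat -> k.

Let expm1_0 : expm1 0 = 0.
Proof. by rewrite /expm1 !fctE /ps_exp /ps_mon /= expr0 divr1 subrr. Qed.

Let expm1_S n : expm1 n.+1 = ps_expm1_div n.
Proof. by rewrite /expm1 !fctE /ps_exp /ps_mon /= expr1n mul1r subr0. Qed.

Let expm1_1 : expm1 1 != 0.
Proof. by rewrite expm1_S /ps_expm1_div invr1 oner_eq0. Qed.

(** Comparing coefficients of z^(n+1) in the identity that defines the quotient cancels one factor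
    z. *)
Lemma todd_minus_expm1 : ps_mul (todd_minus k) ps_expm1_div = ps_mon 0 1.
Proof.
have z0 : ps_z k 0 = 0 by [].
have e := ps_divK z0 expm1_0 expm1_1.
apply/funext => n; have := congr1 (@^~ n.+1) e.
rewrite /ps_mul /ps_bil big_ord_recr /= subnn expm1_0 mulr0 addr0.
rewrite [ps_z k n.+1]/ps_z /ps_mon eqSS => <-.
by apply: eq_bigr => i _; rewrite subSn ?expm1_S // -ltnS.
Qed.

(** Substituting -z for z in z / (e^z - 1) gives z / (1 - e^(-z)); uniqueness of the quotient
    identifies the two series. *)
Lemma todd_plusE m : todd_plus k m = (-1) ^+ m * todd_minus k m.
Proof.
have z0 : ps_z k 0 = 0 by [].
have e := ps_divK z0 expm1_0 expm1_1.
pose h m := (-1) ^+ m * todd_minus k m.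
have nexpE n : (ps_mon 0 1 - ps_exp (-1)) n = - (-1) ^+ n * expm1 n :> k.
  rewrite /expm1 !fctE /ps_exp /ps_mon /= expr1n mul1r.
  case: n => [|n] /=; first by rewrite expr0 fact0 !divr1 invr1 subrr mulr0.
  by rewrite !subr0 sub0r mulNr.
suff -> : todd_plus k = h by [].
apply: ps_div_unique; rewrite ?nexpE ?expm1_0 ?mulr0 //.
  by rewrite expr1 opprK mul1r.
apply/funext => n; have := congr1 (@^~ n) e; rewrite /ps_mul /ps_bil /= => en.
transitivity (- (-1) ^+ n * ps_z k n).
  rewrite -en mulr_sumr; apply: eq_bigr => i _.
  rewrite nexpE /h mulrACA mulrN -exprD subnKC ?mulrA //.
  by rewrite -ltnS.
rewrite /ps_z /ps_mon; case: eqP => [->|_]; last by rewrite mulr0.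
by rewrite expr1 opprK mul1r.
Qed.

End ToddSeries.

(* For commuting l and r this is (e^l - e^r) / (l - r) =
   e^r (e^(l - r) - 1) / (l - r), the left-hand side being the sum of the
   (l^n - r^n) / (l - r) / n!. *)
Section ExpDifference.
Variables (k : fieldType) (V : lmodType k) (l r : (nat -> V) -> nat -> V).
Hypotheses (char0 : [pchar k] =i pred0) (l_r : raising l) (r_r : raising r).
Hypothesis lrC : forall v, l (r v) = r (l v).
Variables (u : nat -> nat -> V) (v : nat -> V).
Hypotheses (u0 : u 0 = 0) (uS : forall n, u n.+1 = l (u n) + iter n r v).

Lemma iter_comm n w : l (iter n r w) = iter n r (l w).
Proof. by elim: n => //= n <-; rewrite lrC. Qed.

Let d w := l w - r w.

(** Here [u n.+1] is ((l^(n+1) - r^(n+1)) / d)(v) with l = r + d; the binomial expansion of (r +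
    d)^(n+1) loses its term r^(n+1), and one factor d is divided out. *)
Lemma diff_iterE n : u n.+1 =
  \sum_(p < n.+1) ('C(n.+1, p)%:R : k) *: iter p r (iter (n - p) d v).
Proof.
elim: n => [|n IH].
  by rewrite uS u0 (lin0 (raising_lin l_r)) add0r big_ord1 scale1r.
pose c p := iter p r (iter (n.+1 - p) d v).
(* Since l = d + r commutes with [r], it sends the p-th term to [c p + c p.+1]; Pascal's rule then
   collects the coefficients. *)
have cE : u n.+2 =
    \sum_(p < n.+1) ('C(n.+1, p)%:R : k) *: (c p + c p.+1) + c n.+1.
  rewrite uS IH /c subnn (lin_sum (raising_lin l_r)); congr (_ + _).
  apply: eq_bigr => p _; rewrite (linZ (raising_lin l_r)) iter_comm.
  rewrite subSS subSn ?(ltnSE (ltn_ord p)) //=.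
  rewrite [r (iter _ _ _)](iterSr p r) -(linD (iter_lin p (raising_lin r_r))).
  by rewrite subrK.
transitivity (\sum_(p < n.+2) ('C(n.+2, p)%:R : k) *: c p); last by [].
rewrite cE [RHS]big_ord_recl bin0 scale1r.
under [in RHS]eq_bigr do rewrite lift0 binS natrD scalerDl.
rewrite big_split /= [RHS]addrA.
under eq_bigr do rewrite scalerDr.
rewrite big_split /= [LHS]addrAC; congr (_ + _).
transitivity (\sum_(p < n.+2) ('C(n.+1, p)%:R : k) *: c p).
  by rewrite [RHS]big_ord_recr /= binn scale1r.
by rewrite big_ord_recl bin0 scale1r.
Qed.

Lemma ps_exp_difference : (forall n, vanish n (u n)) ->
  ps_sum (fun n => (n`!%:R^-1 : k) *: u n) =
  ps_eval (ps_exp 1) r (ps_eval (ps_expm1_div k) d v).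
Proof.
move=> u_van; rewrite ps_sumS => [|n]; last exact: vanishZ.
rewrite u0 scaler0 add0r ps_eval_ps_eval //; last exact: raisingB.
apply: eq_ps_sum => n; rewrite diff_iterE scaler_sumr; apply: eq_bigr => p _.
(* It remains that C(n+1, p) / (n+1)! = 1 / (p! (n+1-p)!), where n+1-p = (n-p)+1 is the index shift
   in [ps_expm1_div]. *)
rewrite scalerA; congr (_ *: _); rewrite /ps_exp expr1n mul1r /ps_expm1_div.
have pn : (p <= n.+1)%N by apply: ltnW.
have q_unit : (p`!%:R * (n - p).+1`!%:R : k) != 0.
  by rewrite mulf_neq0 ?fact_unit.
apply: (mulIf q_unit); rewrite -[in RHS]invfM mulVf // -mulrA -!natrM -subSn.
  by rewrite bin_fact // mulVf ?fact_unit.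
by rewrite -ltnS.
Qed.

End ExpDifference.

(** * The exponential in a twisted dendriform algebra *)

Section Bimodule.
Variables (k : fieldType) (D : twistedDendriformType k).
Implicit Types (d m : D) (x y : augm D).

(** Both actions are total: the module element lies in D, so neither half-product of 1 with itself
    occurs, and 1 acts as the identity. *)
Definition lact x m : D := tsucc x.1 m + (x.2 : k) *: m.
Definition ract m x : D := tprec m (tPhi x.1) + (x.2 : k) *: m.
(* The right action of D, which is the ordinary dendriform product <'. *)
Definition tprec_Phi m d : D := tprec m (tPhi d).

Lemma tprec_Phi_linl d : linear (tprec_Phi^~ d).
Proof. by move=> c u v; rewrite /tprec_Phi tprec_linearl. Qed.

Lemma tprec_Phi_linr m : linear (tprec_Phi m).
Proof. by move=> c u v; rewrite /tprec_Phi tPhi_linear tprec_linearr. Qed.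

Lemma lact_linl m : linear (lact^~ m).
Proof.
move=> c x y; rewrite /lact /= tsucc_linearl scalerDl -scalerA scalerDr.
by rewrite addrACA.
Qed.

Lemma lact_linr x : linear (lact x).
Proof.
move=> c u v; rewrite /lact tsucc_linearr !scalerDr addrACA.
by rewrite !scalerA [_ * c]mulrC.
Qed.

Lemma ract_linl x : linear (ract^~ x).
Proof.
move=> c u v; rewrite /ract tprec_linearl !scalerDr addrACA.
by rewrite !scalerA [_ * c]mulrC.
Qed.

Lemma ract_linr m : linear (ract m).
Proof.
move=> c x y; rewrite /ract /= tPhi_linear tprec_linearr scalerDl -scalerA.
by rewrite scalerDr addrACA.
Qed.

Lemma lact1 m : lact aug_one m = m.
Proof. by rewrite /lact (lin0 (tsucc_linearl _)) add0r scale1r. Qed.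

Lemma ract1 m : ract m aug_one = m.
Proof.
by rewrite /ract (lin0 tPhi_linear) (lin0 (tprec_linearr _)) add0r scale1r.
Qed.

Lemma aug_in_linear : linear (@aug_in k D).
Proof. by move=> c u v; congr (_, _); rewrite /= scaler0 addr0. Qed.

Lemma aug_star_in d y :
  aug_star (aug_in d) y = aug_in (tsucc d y.1 + ract d y).
Proof. by rewrite /aug_star /= scale0r addr0 mul0r addrA. Qed.

(** The left module axiom, from [tsucc_succ]. The first factor lies in D because [ps_star_pow] adds
    such factors on the left. *)
Lemma lact_star d y m : lact (aug_star (aug_in d) y) m = tsucc d (lact y m).
Proof.
rewrite aug_star_in /lact /= scale0r addr0 (linD (tsucc_linearr _)).
rewrite (linZ (tsucc_linearr _)) tsucc_succ /ract addrA.
by rewrite (linD (tsucc_linearl _)) (linZ (tsucc_linearl _)).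
Qed.

(** Multiplicativity of Phi absorbs the twist: it turns [tprec_prec] into the ordinary dendriform
    axiom for <'. *)
Lemma ract_star d y m : ract m (aug_star (aug_in d) y) = ract (tprec_Phi m d) y.
Proof.
rewrite aug_star_in /ract /tprec_Phi /= scale0r addr0 tprec_prec addrA.
rewrite !(linD tPhi_linear) tPhi_succ tPhi_prec (linZ tPhi_linear).
by rewrite !(linD (tprec_linearr _)) (linZ (tprec_linearr _)).
Qed.

Lemma tsucc_tprec_Phi c m d :
  tsucc c (tprec_Phi m d) = tprec_Phi (tsucc c m) d.
Proof. by rewrite /tprec_Phi tsucc_prec. Qed.

Lemma trhd_linl d : linear ((@trhd k D)^~ d).
Proof.
move=> c u v; rewrite /trhd tsucc_linearl tPhi_linear tprec_linearr.
by rewrite opprD addrACA -scalerBr.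
Qed.

Lemma trhd_linr d : linear (@trhd k D d).
Proof.
move=> c u v; rewrite /trhd tsucc_linearr tprec_linearl.
by rewrite opprD addrACA -scalerBr.
Qed.

End Bimodule.

Section ExpStar.
Variables (k : fieldType) (D : twistedDendriformType k).
Hypothesis char0 : [pchar k] =i pred0.
Variable Om : nat -> D.
Hypothesis Om0 : Om 0 = 0.

Let iota : (nat -> D) -> nat -> augm D := ps_map (@aug_in k D).
Let l := ps_bil (@tsucc k D) Om.
Let r v := ps_bil (@tprec_Phi k D) v Om.
Let pow := ps_star_pow (iota Om).
(** The n-th power of Omega' without its component along 1; only for n = 0 does this lose anything,
    and [u 0] is 0. *)
Let u n : nat -> D := ps_map fst (pow n).

Let Om_van : vanish 1 Om.
Proof. by case. Qed.

Let l_raising : raising l.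
Proof.
split=> [|n v vn]; first by apply: ps_bil_linr; apply: tsucc_linearr.
apply: (ps_bil_vanish (@tsucc_linearl k D) (@tsucc_linearr k D) Om_van vn).
Qed.

Let r_raising : raising r.
Proof.
split=> [|n v vn]; first by apply: (ps_bil_linl (@tprec_Phi_linl k D)).
rewrite -addn1.
apply: (ps_bil_vanish (@tprec_Phi_linl k D) (@tprec_Phi_linr k D) vn Om_van).
Qed.

Let lrC v : l (r v) = r (l v).
Proof.
apply/esym/ps_bilA; [exact: tprec_Phi_linl|exact: tsucc_linearr|].
by move=> x m d; rewrite tsucc_tprec_Phi.
Qed.

Lemma L_rhdE : L_rhd Om = (fun v => l v - r v).
Proof.
apply/funext => v; apply/funext => n; rewrite !fctE /l /r /L_rhd /ps_bil sumrB.
congr (_ - _); rewrite [RHS](reindex_inj rev_ord_inj) /=.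
by apply: eq_bigr => i _; rewrite subSS subKn // -ltnS.
Qed.

Let powS n : pow n.+1 = iota (l (u n) + ps_bil (@ract k D) Om (pow n)).
Proof.
apply/funext => i; rewrite /iota /ps_map !fctE /= /ps_bil -big_split /=.
rewrite (lin_sum (@aug_in_linear k D)); apply: eq_bigr => j _.
by rewrite -aug_star_in.
Qed.

Let ract_pow n m : ps_bil (@ract k D) m (pow n) = iter n r m.
Proof.
elim: n m => [|n IH] m.
  rewrite (ps_bil_mon0r (@ract_linr k D)); apply/funext => i.
  exact: ract1.
rewrite iterSr -IH; apply/esym.
apply: (@ps_bilA _ _ _ _ _ _ _ _ _ _ (fun d y => aug_star (aug_in d) y)).
- exact: ract_linl.
- exact: ract_linr.
- by move=> x d y; rewrite ract_star.
Qed.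

Let lact_pow n m : ps_bil (@lact k D) (pow n) m = iter n l m.
Proof.
elim: n => [|n IH].
  rewrite (ps_bil_mon0l (@lact_linl k D)); apply/funext => i.
  exact: lact1.
rewrite iterS -IH.
apply: (@ps_bilA _ _ _ _ _ _ _ _ (fun d y => aug_star (aug_in d) y)).
- exact: lact_linl.
- exact: tsucc_linearr.
- exact: lact_star.
Qed.

Let uS n : u n.+1 = l (u n) + iter n r Om.
Proof. by rewrite -ract_pow /u powS. Qed.

Let u0 : u 0 = 0.
Proof. by apply/funext => -[]. Qed.

Let u_van n : vanish n (u n).
Proof.
elim: n => // n IH i lin; rewrite uS fctE (raising_vanish l_raising IH lin).
by rewrite (iter_vanish r_raising Om_van) ?addn1 ?addr0.
Qed.

(** The expression (l^n - r^n) / (l - r) is symmetric in [l] and [r]; the induction rests on their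
    commuting. *)
Let uS_sym n : u n.+1 = r (u n) + iter n l Om.
Proof.
elim: n => [|n IH].
  rewrite uS u0 (lin0 (raising_lin l_raising)).
  by rewrite (lin0 (raising_lin r_raising)).
rewrite uS [u n.+1 in LHS]IH [in RHS]uS (linD (raising_lin l_raising)).
by rewrite (linD (raising_lin r_raising)) lrC addrAC.
Qed.

Let powSE n : pow n.+1 = iota (u n.+1).
Proof. by rewrite /u powS. Qed.

Let iota_linear : linear iota.
Proof.
by move=> c x y; apply/funext => n; rewrite /iota /ps_map aug_in_linear.
Qed.

Let iota_vanish n v : vanish n v -> vanish n (iota v).
Proof.
by move=> vn i /vn vi; rewrite /iota /ps_map vi (lin0 (@aug_in_linear k D)).
Qed.

Let pow_vanish n : vanish n (pow n).
Proof. by case: n => [//|n]; rewrite powSE; apply: iota_vanish. Qed.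

Lemma exp_star_sum : exp_star Om =
  ps_mon 0 aug_one + iota (ps_sum (fun n => (n`!%:R^-1 : k) *: u n)).
Proof.
rewrite /exp_star ps_sumS => [|n]; last by apply/vanishZ/pow_vanish.
rewrite invr1 scale1r; congr (_ + _).
rewrite [in RHS]ps_sumS => [|n]; last by apply/vanishZ/u_van.
rewrite u0 scaler0 add0r lin_ps_sum // => [|n].
  by apply: eq_ps_sum => n; rewrite (linZ iota_linear) -powSE.
by apply/vanishZ/(vanish_le (leqnSn n))/u_van.
Qed.

(** The n-th power of Omega' acts on the right as r^n. This turns the factor e^r of (e^l - e^r) / (l
    - r) into the action of exp(Omega'). *)
Let ract_exp_star m :
  ps_bil (@ract k D) m (exp_star Om) = ps_eval (ps_exp 1) r m.
Proof.
have ract_lin := ps_bil_linr (@ract_linr k D) m.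
rewrite /exp_star (lin_ps_sum ract_lin).
- apply: eq_ps_sum => n.
  by rewrite (linZ ract_lin) ract_pow /ps_exp expr1n mul1r.
- move=> n x xn; have m_van : vanish 0 m by [].
  exact: (ps_bil_vanish (@ract_linl k D) (@ract_linr k D) m_van xn).
- by move=> n; apply/vanishZ/pow_vanish.
Qed.

Let lact_exp_star m :
  ps_bil (@lact k D) (exp_star Om) m = ps_eval (ps_exp 1) l m.
Proof.
have lact_lin := ps_bil_linl (@lact_linl k D) m.
rewrite /exp_star (lin_ps_sum lact_lin).
- apply: eq_ps_sum => n.
  by rewrite (linZ lact_lin) lact_pow /ps_exp expr1n mul1r.
- move=> n x xn; have m_van : vanish 0 m by [].
  have := ps_bil_vanish (@lact_linl k D) (@lact_linr k D) xn m_van.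
  by rewrite addn0.
- by move=> n; apply/vanishZ/pow_vanish.
Qed.

Lemma exp_star_ract : exp_star Om = ps_mon 0 aug_one +
  ps_map (@aug_in k D) (ps_bil (@ract k D)
    (ps_eval (ps_expm1_div k) (L_rhd Om) Om) (exp_star Om)).
Proof.
rewrite ract_exp_star L_rhdE {1}exp_star_sum.
by rewrite (ps_exp_difference char0 l_raising r_raising lrC u0 uS).
Qed.

(** With [l] and [r] exchanged, the difference becomes r - l = L_rhd(-Omega') and the factor pulled
    out is e^l, the left action of exp(Omega'). *)
Lemma exp_star_lact : exp_star Om = ps_mon 0 aug_one +
  ps_map (@aug_in k D) (ps_bil (@lact k D) (exp_star Om)
    (ps_eval (ps_expm1_div k) (L_rhd (- Om)) Om)).
Proof.
have -> : L_rhd (- Om) = (fun v => r v - l v).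
  apply/funext => v; rewrite /L_rhd (linN (ps_bil_linl (@trhd_linl k D) v)).
  by rewrite -/(L_rhd Om v) L_rhdE opprB.
rewrite lact_exp_star {1}exp_star_sum.
have rlC v : r (l v) = l (r v) by [].
by rewrite (ps_exp_difference char0 r_raising l_raising rlC u0 uS_sym).
Qed.

End ExpStar.

(** * The equations of X, Y and Omega' as contractions *)

Section Equations.
Variables (k : fieldType) (D : twistedDendriformType k).
Implicit Types (X Y : nat -> augm D) (a : D) (b Om x y v : nat -> D).

Lemma aug_in_mon a : ps_mon 1 (aug_in a) = ps_map (@aug_in k D) (ps_mon 1 a).
Proof. by apply/funext => n; rewrite /ps_map /ps_mon; case: eqP. Qed.

Lemma X_solutionE a X : X_solution a X <->
  X = ps_mon 0 aug_one +
      ps_map (@aug_in k D) (ps_bil (@ract k D) (ps_mon 1 a) X).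
Proof.
rewrite /X_solution aug_in_mon.
suff -> : ps_bil (@aug_prec k D) (ps_map (@aug_in k D) (ps_mon 1 a))
    (ps_map (@aug_Phi k D) X) =
  ps_map (@aug_in k D) (ps_bil (@ract k D) (ps_mon 1 a) X) by [].
by apply/funext => n; rewrite /ps_map /ps_bil (lin_sum (@aug_in_linear k D)).
Qed.

Lemma Y_solutionE a Y : Y_solution a Y <->
  Y = ps_mon 0 aug_one -
      ps_map (@aug_in k D) (ps_bil (@lact k D) Y (ps_mon 1 a)).
Proof.
rewrite /Y_solution aug_in_mon.
suff -> : ps_bil (@aug_succ k D) Y (ps_map (@aug_in k D) (ps_mon 1 a)) =
  ps_map (@aug_in k D) (ps_bil (@lact k D) Y (ps_mon 1 a)) by [].
by apply/funext => n; rewrite /ps_map /ps_bil (lin_sum (@aug_in_linear k D)).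
Qed.

Lemma mon1_vanish a : vanish 1 (ps_mon 1 a).
Proof. by case. Qed.

(** The factor lambda a gains one order. *)
Lemma X_contr a n X X' : vanish n (X - X') ->
  vanish n.+1 (ps_mon 0 aug_one +
      ps_map (@aug_in k D) (ps_bil (@ract k D) (ps_mon 1 a) X) -
    (ps_mon 0 aug_one +
      ps_map (@aug_in k D) (ps_bil (@ract k D) (ps_mon 1 a) X'))).
Proof.
move=> XX' i lin; rewrite opprD addrACA subrr add0r !fctE /ps_map.
rewrite -(linB (@aug_in_linear k D)).
have := ps_bil_vanish (@ract_linl k D) (@ract_linr k D)
  (@mon1_vanish a) XX' lin.
rewrite (linB (ps_bil_linr (@ract_linr k D) _)) !fctE => ->.
exact: (lin0 (@aug_in_linear k D)).
Qed.

Lemma Y_contr a n Y Y' : vanish n (Y - Y') ->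
  vanish n.+1 (ps_mon 0 aug_one -
      ps_map (@aug_in k D) (ps_bil (@lact k D) Y (ps_mon 1 a)) -
    (ps_mon 0 aug_one -
      ps_map (@aug_in k D) (ps_bil (@lact k D) Y' (ps_mon 1 a)))).
Proof.
move=> YY' i lin; rewrite opprD addrACA subrr add0r -opprD !fctE /ps_map.
rewrite -(linB (@aug_in_linear k D)).
have := ps_bil_vanish (@lact_linl k D) (@lact_linr k D) YY' (@mon1_vanish a).
rewrite addn1 => /(_ i lin).
rewrite (linB (ps_bil_linl (@lact_linl k D) _)) !fctE => ->.
by rewrite (lin0 (@aug_in_linear k D)) oppr0.
Qed.

Lemma L_rhd_raising Om : Om 0 = 0 -> raising (L_rhd Om).
Proof.
move=> Om0; split=> [|n v vn]; first exact: (ps_bil_linr (@trhd_linr k D)).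
apply: (ps_bil_vanish (@trhd_linl k D) (@trhd_linr k D) (m := 1)) => //.
by case.
Qed.

(** The extra order comes from [v], so the contraction property holds for arbitrary series [x] and
    [y], as [fix_exists] requires. *)
Lemma iter_L_rhd_contr n p x y v : vanish 1 v -> vanish n (x - y) ->
  vanish n.+1 (iter p (L_rhd x) v - iter p (L_rhd y) v).
Proof.
have van := ps_bil_vanish (@trhd_linl k D) (@trhd_linr k D).
move=> v1 xy; elim: p => [|p IH]; first by rewrite subrr.
have iter1 : vanish 1 (iter p (L_rhd x) v).
  elim: p {IH} => //= p IH.
  by apply: (vanish_le _ (van 0 1 _ _ _ IH)).
set w := iter p (L_rhd x) v in iter1 IH *.
set w' := iter p (L_rhd y) v in IH *.
(* In this bilinear telescoping the first summand gains its order from [w], the second from the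
   induction hypothesis. *)
have -> : iter p.+1 (L_rhd x) v - iter p.+1 (L_rhd y) v =
    L_rhd (x - y) w + L_rhd y (w - w').
  rewrite /L_rhd (linB (ps_bil_linl (@trhd_linl k D) _)).
  by rewrite (linB (ps_bil_linr (@trhd_linr k D) _)) addrA subrK.
apply: vanishD; last by apply: (van 0) IH.
by have := van _ _ _ _ xy iter1; rewrite addn1.
Qed.

Lemma ps_eval_L_rhd_contr (f : nat -> k) n x y v :
  vanish 1 v -> vanish n (x - y) ->
  vanish n.+1 (ps_eval f (L_rhd x) v - ps_eval f (L_rhd y) v).
Proof.
move=> v1 xy i lin; rewrite !fctE /ps_eval /ps_sum -sumrB big1 // => p _.
rewrite !fctE -scalerBr.
have := iter_L_rhd_contr p v1 xy lin.
by rewrite !fctE => ->; rewrite scaler0.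
Qed.

(** With constant term 1 in [X] the system is unitriangular: the n-th coefficient of b <' X is [b n]
    plus terms in the earlier coefficients of [b]. *)
Lemma ract_inj b b' X : X 0 = aug_one ->
  ps_bil (@ract k D) b X = ps_bil (@ract k D) b' X -> b = b'.
Proof.
move=> X0 bb'; apply: vanish_eq; elim=> // n IH i.
rewrite ltnS leq_eqVlt => /predU1P[->|/IH //].
have ract_lin := ps_bil_linl (@ract_linl k D) X.
have /(congr1 (@^~ n)) : ps_bil (@ract k D) (b - b') X = 0.
  by rewrite (linB ract_lin) bb' subrr.
rewrite /ps_bil big_ord_recr /= subnn X0 ract1 big1 ?add0r // => j _.
by rewrite IH // (lin0 (@ract_linl k D _)).
Qed.

Lemma R_lhdE Om : R_lhd Om = (fun v => - L_rhd Om v).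
Proof.
apply/funext => v; apply/funext => n; rewrite !fctE /R_lhd /L_rhd /ps_bil.
rewrite -sumrN [RHS](reindex_inj rev_ord_inj) /=; apply: eq_bigr => i _.
by rewrite subSS subKn // -ltnS.
Qed.

End Equations.

(** * Equivalence of the recursion with the equation of X *)

Section Magnus.
Variables (k : fieldType) (D : twistedDendriformType k) (a : D).
Hypothesis char0 : [pchar k] =i pred0.
Implicit Type Om : nat -> D.

Lemma exp_star0 Om : exp_star Om 0 = aug_one.
Proof. by rewrite /exp_star /ps_sum big_ord1 fctE /= invr1 scale1r. Qed.

Lemma expm1_div_todd Om v : Om 0 = 0 ->
  ps_eval (ps_expm1_div k) (L_rhd Om) (ps_eval (todd_minus k) (L_rhd Om) v) = v.
Proof.
move=> Om0; rewrite ps_eval_mul; last exact: L_rhd_raising.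
by rewrite ps_mulC todd_minus_expm1 ps_eval1.
Qed.

Lemma todd_expm1_div Om v : Om 0 = 0 ->
  ps_eval (todd_minus k) (L_rhd Om) (ps_eval (ps_expm1_div k) (L_rhd Om) v) = v.
Proof.
move=> Om0; rewrite ps_eval_mul; last exact: L_rhd_raising.
by rewrite todd_minus_expm1 ps_eval1.
Qed.

(** One direction produces X from a fixed point of the recursion, the other shows that every
    logarithm of X is such a fixed point. *)
Lemma X_solution_exp_star Om : Om 0 = 0 -> X_solution a (exp_star Om) <->
  Om = ps_eval (todd_minus k) (L_rhd Om) (ps_mon 1 a).
Proof.
move=> Om0; rewrite X_solutionE; split=> [Xa|OmE]; last first.
  rewrite {1}(exp_star_ract char0 Om0).
  by rewrite [X in ps_eval _ _ X]OmE expm1_div_todd.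
have := exp_star_ract char0 Om0; rewrite [LHS]Xa => /addrI eq_in.
suff -> : ps_mon 1 a = ps_eval (ps_expm1_div k) (L_rhd Om) Om.
  by rewrite todd_expm1_div.
apply: (ract_inj (exp_star0 Om)); apply/funext => n.
exact: (congr1 (fun f : nat -> augm D => (f n).1) eq_in).
Qed.

Lemma Y_solution_exp_star Om : Om 0 = 0 ->
  Om = ps_eval (todd_minus k) (L_rhd Om) (ps_mon 1 a) ->
  Y_solution a (exp_star (- Om)).
Proof.
move=> Om0 OmE; apply/Y_solutionE.
have NOm0 : (- Om) 0 = 0 by rewrite fctE Om0 oppr0.
(* At -Omega' the operator is L_rhd(-(-Omega')) = L_rhd(Omega'); the remaining sign is moved out by
   linearity. *)
rewrite {1}(exp_star_lact char0 NOm0) opprK; congr (_ + _).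
have g_lin : linear (ps_eval (ps_expm1_div k) (L_rhd Om)).
  move=> c u v; apply/funext => n.
  rewrite !fctE /ps_eval /ps_sum scaler_sumr -big_split /=.
  apply: eq_bigr => i _; rewrite !fctE.
  rewrite (iter_lin i (raising_lin (L_rhd_raising Om0))).
  by rewrite !fctE scalerDr !scalerA mulrC.
rewrite (linN g_lin) [X in ps_eval _ _ X]OmE expm1_div_todd //.
rewrite (linN (ps_bil_linr (@lact_linr k D) _)); apply/funext => n.
by rewrite /ps_map !fctE (linN (@aug_in_linear k D)).
Qed.

(** The sign (-1)^m of the series cancels the one from R_lhd(Omega') = -L_rhd(Omega'). *)
Lemma ps_eval_todd_plus Om v :
  ps_eval (todd_plus k) (R_lhd Om) v = ps_eval (todd_minus k) (L_rhd Om) v.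
Proof.
apply: eq_ps_sum => m; rewrite todd_plusE //.
have -> : iter m (R_lhd Om) v = ((-1) ^+ m : k) *: iter m (L_rhd Om) v.
  elim: m => [|m IH]; first by rewrite scale1r.
  rewrite /= IH R_lhdE exprS mulN1r scaleNr; congr (- _).
  exact: (linZ (ps_bil_linr (@trhd_linr k D) Om)).
by rewrite scalerA mulrAC -expr2 sqrr_sign mul1r.
Qed.

End Magnus.

Lemma bernoulli_fact (k : fieldType) (char0 : [pchar k] =i pred0) m :
  bernoulli k m / m`!%:R = todd_minus k m.
Proof. by rewrite /bernoulli mulrAC divff ?mul1r ?fact_unit. Qed.

Theorem theorem8 (k : fieldType) (D : twistedDendriformType k) (a : D)
    (char0 : [pchar k] =i pred0) :
  (exists! X : nat -> augm D, X_solution a X) /\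
  forall X : nat -> augm D, X_solution a X ->
    (exists! Om : nat -> D, Om 0%N = 0 /\ X = exp_star Om) /\
    forall Om : nat -> D, Om 0%N = 0 -> X = exp_star Om ->
      (forall Y : nat -> augm D, Y_solution a Y <-> Y = exp_star (- Om)) /\
      (Om = ps_eval (todd_plus k) (R_lhd Om) (ps_mon 1 a) /\
       ps_eval (todd_plus k) (R_lhd Om) (ps_mon 1 a) =
         ps_sum (fun m => ((-1) ^+ m * (bernoulli k m / m`!%:R)) *:
                          iter m (R_lhd Om) (ps_mon 1 a))) /\
      (Om = ps_eval (todd_minus k) (L_rhd Om) (ps_mon 1 a) /\
       ps_eval (todd_minus k) (L_rhd Om) (ps_mon 1 a) =
         ps_sum (fun m => (bernoulli k m / m`!%:R) *:
                          iter m (L_rhd Om) (ps_mon 1 a))).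
Proof.
have X_unique X X' : X_solution a X -> X_solution a X' -> X = X'.
  by move=> /X_solutionE + /X_solutionE; apply: (fix_unique (@X_contr k D a)).
have Y_unique Y Y' : Y_solution a Y -> Y_solution a Y' -> Y = Y'.
  by move=> /Y_solutionE + /Y_solutionE; apply: (fix_unique (@Y_contr k D a)).
have Om_contr n x y : vanish n (x - y) -> _ :=
  ps_eval_L_rhd_contr (todd_minus k) (@mon1_vanish k D a).
(* Omega' is constructed first, from its recursion, and X is then obtained as its exponential. *)
have [Om OmE] := fix_exists Om_contr.
have Om0 : Om 0 = 0.
  by rewrite OmE /ps_eval /ps_sum big_ord1 fctE scaler0.
have X_Om : X_solution a (exp_star Om) by apply/X_solution_exp_star.
split; first by exists (exp_star Om); split=> // X; apply: X_unique.
move=> X X_sol; split.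
  exists Om; split=> [|Om' [Om'0 XE]].
    by split=> //; apply: X_unique X_sol X_Om.
  (* Any other logarithm of X solves the same fixed point equation. *)
  apply: (fix_unique Om_contr OmE); apply/X_solution_exp_star => //.
  by rewrite -XE.
move=> {OmE Om0 X_Om} {}Om Om0 XE.
have OmE : Om = ps_eval (todd_minus k) (L_rhd Om) (ps_mon 1 a).
  by apply/X_solution_exp_star; rewrite -?XE.
split=> [Y|].
  have Y_Om := Y_solution_exp_star char0 Om0 OmE.
  by split=> [Y_sol|->//]; apply: Y_unique Y_sol Y_Om.
split; split.
- by rewrite ps_eval_todd_plus.
- by apply: eq_ps_sum => m; rewrite todd_plusE bernoulli_fact.
- exact: OmE.
- by apply: eq_ps_sum => m; rewrite bernoulli_fact.
Qed.
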